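(* Let $c,c':\mathbb R^2\to S_0(\mathbb R^3)$ be the linear maps given on the standard basis $\{Z_1,Z_2\}$ of $\mathbb R^2$ by $$c_{Z_1}=c'_{Z_1}=\begin{pmatrix}-1&0&0\\0&0&0\\0&0&1\end{pmatrix},\quad c_{Z_2}=\begin{pmatrix}0&1&0\\1&0&1\\0&1&0\end{pmatrix},\quad c'_{Z_2}=\begin{pmatrix}0&0&\sqrt2\\0&0&0\\\sqrt2&0&0\end{pmatrix},$$ and let $g_\lambda$, $g_{\lambda'}$ be the Riemannian metrics on $S^2\times T^2$ associated with $c$ and $c'$, respectively. Then the maximal scalar curvature equals $2$ for both metrics. Its preimage under $\mathrm{scal}^{g_\lambda}$ is $$\bigl(\{p\in S^2\mid p_1=-p_3\}\cup\{(\pm1/\sqrt2,0,\pm1/\sqrt2)\}\bigr)\times T^2$$ and thus contains a submanifold of codimension one, whereas its preimage under $\mathrm{scal}^{g_{\lambda'}}$ is $\{(0,\pm1,0)\}\times T^2$ and thus is of codimension two.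
   Context: $S_0(\mathbb R^3)$ is the space of symmetric traceless endomorphisms of $\mathbb R^3$, identified with matrices with respect to the standard basis. $S^2\subset\mathbb R^3$ is the unit sphere with its standard round metric $h$; $T^2=\mathbb R^2/\mathcal L$ for a uniform lattice $\mathcal L\subset\mathbb R^2$, with the metric induced by the euclidean metric. With a linear map $c:\mathbb R^2\to S_0(\mathbb R^3)$ one associates the $\mathbb R^2$-valued $1$-form $\lambda$ on $S^2$ with $\langle\lambda(X),Z\rangle=\langle c_Zp\times p,X\rangle$ for $p\in S^2$, $X\in T_pS^2$, $Z\in\mathbb R^2$ ($\times$ the vector product, $\langle\,,\rangle$ the standard scalar products), and the metric $g_\lambda$ on $S^2\times T^2$ given, under $T_{(p,z)}(S^2\times T^2)\cong T_pS^2\times\mathbb R^2$, by $$g_\lambda((X,Z),(Y,W))=h(X,Y)+\langle\lambda(X)+Z,\lambda(Y)+W\rangle.$$ The form $\lambda'$ and the metric $g_{\lambda'}$ are defined in the same way from $c'$. $\mathrm{scal}^g$ denotes the scalar curvature function of $g$. *)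

(* Defs.v *)
From HB Require Import structures.
From mathcomp Require Import all_boot all_order all_algebra.
From mathcomp Require Import all_classical all_reals all_analysis.
From mathcomp Require Import ring lra.

Set Implicit Arguments.
Unset Strict Implicit.
Unset Printing Implicit Defensive.

Import Order.TTheory GRing.Theory Num.Theory.
Import numFieldNormedType.Exports.

Local Open Scope classical_set_scope.
Local Open Scope ring_scope.

(* Vectors of R^n are row vectors; a matrix A acts on p : 'rV_n as the
   endomorphism with matrix A in the standard basis, i.e. p |-> (A p^T)^T. *)

Section Euclidean.
Context {R : realType}.

Definition stdbasis {n} (i : 'I_n) : 'rV[R]_n := delta_mx 0 i.

Definition dot {n} (u v : 'rV[R]_n) : R := \sum_i u 0 i * v 0 i.

Definition vec3 (a b c : R) : 'rV[R]_3 := \row_j nth 0 [:: a; b; c] j.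

Definition mat3 (rows : seq (seq R)) : 'M[R]_3 :=
  \matrix_(i, j) nth 0 (nth [::] rows i) j.

Definition crossmul (u v : 'rV[R]_3) : 'rV[R]_3 :=
  vec3 (u 0 1 * v 0 2%:R - u 0 2%:R * v 0 1)
       (u 0 2%:R * v 0 0 - u 0 0 * v 0 2%:R)
       (u 0 0 * v 0 1 - u 0 1 * v 0 0).

Definition mxact {n} (A : 'M[R]_n) (p : 'rV[R]_n) : 'rV[R]_n := (A *m p^T)^T.

End Euclidean.

Section SymmetricTraceless.
Variables (R : realType) (n : nat).

Definition symtraceless : {pred 'M[R]_n} :=
  fun A => (A^T == A) && (\tr A == 0).

Lemma symtraceless_submod_closed : submod_closed symtraceless.
Proof.
split=> [|a A B /andP[/eqP sA /eqP tA] /andP[/eqP sB /eqP tB]].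
  by rewrite unfold_in trmx0 mxtrace0 !eqxx.
apply/andP; split; apply/eqP.
  by rewrite linearD linearZ /= sA sB.
by rewrite linearD linearZ /= tA tB mulr0 addr0.
Qed.

HB.instance Definition _ :=
  GRing.isSubmodClosed.Build R 'M[R]_n symtraceless symtraceless_submod_closed.

Record S0 := MkS0 { S0mx :> 'M[R]_n; _ : S0mx \in symtraceless }.

HB.instance Definition _ := [isSub for S0mx].
HB.instance Definition _ := [Choice of S0 by <:].
HB.instance Definition _ := [SubChoice_isSubLmodule of S0 by <:].

End SymmetricTraceless.

(* Scalar curvature of a metric given by its coefficients
    [G u = (g_ij(u))_ij] on (an open subset of) R^n *)

Section CoordinateCurvature.
Context {R : realType} {n : nat}.
Implicit Types (G : 'rV[R]_n -> 'M[R]_n) (u : 'rV[R]_n).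

Definition partial {W : normedModType R} (i : 'I_n) (f : 'rV[R]_n -> W) u : W :=
  'D_(stdbasis i) f u.

(* Gamma^k_ij *)
Definition christoffel G (k i j : 'I_n) u : R :=
  2^-1 * \sum_l invmx (G u) k l *
    (partial i (fun v => G v j l) u + partial j (fun v => G v i l) u
     - partial l (fun v => G v i j) u).

(* R^l_kij, where R(d_i, d_j) d_k = \sum_l R^l_kij d_l and
   R(X, Y) = [nabla_X, nabla_Y] - nabla_[X, Y] *)
Definition riemann G (l k i j : 'I_n) u : R :=
  partial i (christoffel G l j k) u - partial j (christoffel G l i k) u
  + \sum_m (christoffel G l i m u * christoffel G m j k u
            - christoffel G l j m u * christoffel G m i k u).

Definition ricci G (j k : 'I_n) u : R := \sum_i riemann G i k i j u.

Definition scal_coord G u : R :=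
  \sum_j \sum_k invmx (G u) j k * ricci G j k u.

End CoordinateCurvature.

Section Submanifolds.
Context {R : realType} {n : nat}.

Fixpoint Ck_on (r : nat) (U : set 'rV[R]_n) (f : 'rV[R]_n -> R) : Prop :=
  match r with
  | 0 => forall x, U x -> {for x, continuous f}
  | r'.+1 => forall i : 'I_n,
      (forall x, U x -> derivable f x (stdbasis i)) /\ Ck_on r' U (partial i f)
  end.

Definition smooth_on {k} (U : set 'rV[R]_n) (F : 'rV[R]_n -> 'rV[R]_k) : Prop :=
  forall (r : nat) (j : 'I_k), Ck_on r U (fun x => F x 0 j).

(* [N] is locally the zero set of a submersion onto an open subset of R^k *)
Definition submanifold_Rn (k : nat) (N : set 'rV[R]_n) : Prop :=
  forall a, N a -> exists (U : set 'rV[R]_n) (F : 'rV[R]_n -> 'rV[R]_k),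
    [/\ open U, U a, smooth_on U F,
        forall x, U x -> \rank (jacobian F x) = k
      & N `&` U = [set x | F x = 0] `&` U].

End Submanifolds.

(* An additive subgroup; discreteness is part of [uniform_lattice]. *)
Record lattice (R : realType) := Lattice {
  lattice_set : set 'rV[R]_2;
  lattice0 : lattice_set 0;
  latticeB : forall x y, lattice_set x -> lattice_set y -> lattice_set (x - y)
}.

Section Torus.
Context {R : realType} (L : lattice R).

Definition lattice_rel : rel 'rV[R]_2 := fun z w => `[< lattice_set L (z - w) >].

Lemma lattice_rel_equiv : equiv_class_of lattice_rel.
Proof.
split=> [z|z w|w z y].
- by apply/asboolP; rewrite subrr; exact: lattice0.
- have sym a b : lattice_set L (a - b) -> lattice_set L (b - a).
    by move=> Lab; rewrite -opprB -sub0r; apply: latticeB => //; exact: lattice0.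
  by apply/idP/idP => /asboolP /sym Lba; exact/asboolP.
- move=> /asboolP Lzw /asboolP Lwy; apply/asboolP.
  have Lyw : lattice_set L (y - w).
    by rewrite -opprB -sub0r; apply: latticeB => //; exact: lattice0.
  have -> : z - y = (z - w) - (y - w) by rewrite opprB addrA subrK.
  exact: latticeB.
Qed.

Canonical lattice_equiv := EquivRelPack lattice_rel_equiv.

Definition torus := quotient_topology {eq_quot lattice_equiv}%qT.

HB.instance Definition _ := Topological.on torus.

Definition torus_proj : 'rV[R]_2 -> torus := \pi_(torus)%qT.

(* discrete with compact quotient *)
Definition uniform_lattice : Prop :=
  (\forall z \near (0 : 'rV[R]_2), lattice_set L z -> z = 0) /\ compact [set: torus].

End Torus.

Definition sphere2 (R : realType) := {p : 'rV[R]_3 | dot p p == 1}.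

Section Product.
Context {R : realType} (L : lattice R).

Definition S2xT2 : Type := (sphere2 R * torus L)%type.

(* Inverse stereographic projection from the pole (0, 0, 1) (for e = false)
   or (0, 0, -1) (for e = true). *)
Definition stereo (e : bool) (x : 'rV[R]_2) : 'rV[R]_3 :=
  (1 + dot x x)^-1 *:
    vec3 (2 * x 0 0) (2 * x 0 1) ((-1) ^+ e * (dot x x - 1)).

Lemma stereo_sphere e x : dot (stereo e x) (stereo e x) == 1.
Proof.
have q0 : 0 <= dot x x.
  by apply: sumr_ge0 => i _; rewrite -expr2 sqr_ge0.
have q1 : 1 + dot x x != 0 by rewrite gt_eqF // ltr_pwDl.
apply/eqP; rewrite {1}/dot 3!big_ord_recl big_ord0 !mxE /=.
have qE : dot x x = x 0 0 * x 0 0 + x 0 1 * x 0 1.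
  rewrite {1}/dot 2!big_ord_recl big_ord0 addr0.
  by congr (_ + x _ _ * x _ _); apply/val_inj.
have sE : ((-1) ^+ e * (-1) ^+ e : R) = 1 by case: e; rewrite /= ?mulrNN ?mul1r.
set q := dot x x in q0 q1 qE *; set s := (-1) ^+ e in sE *.
set i := (1 + q)^-1; have iE : i * (1 + q) = 1 by rewrite mulVf.
transitivity (i ^+ 2 * (4 * (x 0 0 * x 0 0 + x 0 1 * x 0 1)
                        + (s * s) * (q - 1) ^+ 2)); first by ring.
rewrite sE mul1r -qE (_ : 4 * q + (q - 1) ^+ 2 = (1 + q) ^+ 2); last by ring.
by rewrite -exprMn iE expr1n.
Qed.

(* The lift to R^3 x R^2 of a local parametrization of S^2 x T^2 by
   R^4 = R^2 x R^2: inverse stereographic projection on the first factor, the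
   covering R^2 -> T^2 (which identifies T_zT^2 with R^2) on the second. *)
Definition param_lift (e : bool) (u : 'rV[R]_(2 + 2)) : 'rV[R]_3 * 'rV[R]_2 :=
  (stereo e (lsubmx u), rsubmx u).

Definition param (e : bool) (u : 'rV[R]_(2 + 2)) : S2xT2 :=
  (exist _ (stereo e (lsubmx u)) (stereo_sphere e (lsubmx u)),
   torus_proj L (rsubmx u)).

(* A metric is a function giving at each point q = (p, z) an inner product on
   T_qM = T_pS^2 x R^2, written on the ambient space R^3 x R^2; only its values
   on T_pS^2 x R^2 matter. *)
Definition metric := S2xT2 -> 'rV[R]_3 * 'rV[R]_2 -> 'rV[R]_3 * 'rV[R]_2 -> R.

Definition local_metric (g : metric) (e : bool) (u : 'rV[R]_(2 + 2)) :
    'M[R]_(2 + 2) :=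
  \matrix_(i, j) g (param e u) (partial i (param_lift e) u)
                               (partial j (param_lift e) u).

(* Scalar curvature is a function whose expression in every chart of the atlas
   is [scal_coord]; by [scal_eq] below there is at most one. *)
Definition is_scal (g : metric) (s : S2xT2 -> R) : Prop :=
  forall e u, s (param e u) = scal_coord (local_metric g e) u.

Definition scal (g : metric) : S2xT2 -> R := get (is_scal g).

(* The parametrizations [param e] are local diffeomorphisms which cover the
   manifold, so being a submanifold can be tested on preimages. *)
Definition submanifold (k : nat) (N : set S2xT2) : Prop :=
  forall e, submanifold_Rn k (param e @^-1` N).

Variable c : {linear 'rV[R]_2 -> S0 R 3}.

Definition lambda (p X : 'rV[R]_3) : 'rV[R]_2 :=
  \row_j dot (crossmul (mxact (c (stdbasis j)) p) p) X.

Definition g_lambda : metric := fun q v w =>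
  let p := val q.1 in
  dot v.1 w.1 + dot (lambda p v.1 + v.2) (lambda p w.1 + w.2).

End Product.

Section Facts.
Context {R : realType} (L : lattice R).

Lemma lambdaP (c : {linear 'rV[R]_2 -> S0 R 3}) (p X : 'rV[R]_3) Z :
  dot (lambda c p X) Z = dot (crossmul (mxact (c Z) p) p) X.
Proof.
have -> : c Z =
    Z 0 0 *: c (stdbasis 0) + Z 0 1 *: c (stdbasis 1).
  rewrite {1}(row_sum_delta Z) linear_sum 2!big_ord_recl big_ord0 addr0 !linearZ.
  by congr (Z _ _ *: c (delta_mx _ _) + Z _ _ *: c (delta_mx _ _));
    apply/val_inj.
have cE (a b : R) (A B : S0 R 3) :
    S0mx (a *: A + b *: B) = a *: S0mx A + b *: S0mx B.
  by [].
have mE (a b : R) (A B : 'M[R]_3) : mxact (a *: A + b *: B) p =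
    a *: mxact A p + b *: mxact B p.
  by rewrite /mxact mulmxDl -!scalemxAl linearD !linearZ.
rewrite cE mE.
have xE (a b : R) (u v : 'rV[R]_3) : crossmul (a *: u + b *: v) p =
    a *: crossmul u p + b *: crossmul v p.
  apply/rowP => -[[|[|[|//]]] ?]; rewrite !mxE /=; ring.
rewrite xE /dot 2!big_ord_recl big_ord0 addr0 !mxE.
have -> : lift ord0 (ord0 : 'I_1) = 1 :> 'I_2 by apply/val_inj.
rewrite /dot !mulr_suml -big_split /=; apply: eq_bigr => i _.
by rewrite !mxE; ring.
Qed.

Lemma param_surj (q : S2xT2 L) : exists e u, param L e u = q.
Proof.
case: q => [[p p1] z]; pose e := 0 <= p 0 2%:R; pose s : R := (-1) ^+ e.
have ss : s * s = 1 by rewrite /s -signr_addb addbb.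
have sp : s * p 0 2%:R <= 0.
  rewrite /s /e; case: (leP 0 (p 0 2%:R)) => p2; first by rewrite mulN1r oppr_le0.
  by rewrite mul1r ltW.
have d0 : 1 - s * p 0 2%:R != 0 by rewrite gt_eqF // subr_gt0 (le_lt_trans sp).
pose x : 'rV[R]_2 :=
  (1 - s * p 0 2%:R)^-1 *: \row_j [:: p 0 0; p 0 1]`_j.
have pE : p 0 0 * p 0 0 + p 0 1 * p 0 1 = 1 - p 0 2%:R * p 0 2%:R.
  move/eqP: p1; rewrite /dot 3!big_ord_recl big_ord0 => <-.
  have -> : lift ord0 (ord0 : 'I_2) = 1 :> 'I_3 by apply/val_inj.
  have -> : lift ord0 (lift ord0 (ord0 : 'I_1)) = 2%:R :> 'I_3 by apply/val_inj.
  by ring.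
have xE : dot x x = (1 + s * p 0 2%:R) / (1 - s * p 0 2%:R).
  rewrite /dot 2!big_ord_recl big_ord0 !mxE /=.
  transitivity ((p 0 0 * p 0 0 + p 0 1 * p 0 1) / (1 - s * p 0 2%:R) ^+ 2).
    by field.
  rewrite pE (_ : 1 - _ = (1 - s * p 0 2%:R) * (1 + s * p 0 2%:R)); last first.
    by rewrite -[X in 1 - X]mul1r -[X in X * _]ss; ring.
  by field.
exists e, (row_mx x (repr z)); congr pair; last first.
  by rewrite row_mxKr /torus_proj reprK.
apply/val_inj; rewrite /= row_mxKl /stereo xE.
have -> : (1 + (1 + s * p 0 2%:R) / (1 - s * p 0 2%:R))^-1 =
    (1 - s * p 0 2%:R) / 2 by field; rewrite d0 /= gt_eqF //; lra.
apply/rowP => -[[|[|[|//]]] i]; rewrite !mxE /=.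
- by rewrite (_ : Ordinal i = 0); [field | apply/val_inj].
- by rewrite (_ : Ordinal i = 1); [field | apply/val_inj].
- rewrite (_ : Ordinal i = 2%:R); last exact/val_inj.
  by rewrite -/s -[RHS]mul1r -[in RHS]ss; field.
Qed.

Lemma g_lambda_sym (c : {linear 'rV[R]_2 -> S0 R 3}) q v w :
  g_lambda (L := L) c q v w = g_lambda (L := L) c q w v.
Proof.
by congr (_ + _); apply: eq_bigr => i _; rewrite mulrC.
Qed.

Lemma g_lambda_pos (c : {linear 'rV[R]_2 -> S0 R 3}) q v :
  v != 0 -> 0 < g_lambda (L := L) c q v v.
Proof.
have dot_ge0 n (u : 'rV[R]_n) : 0 <= dot u u.
  by apply: sumr_ge0 => i _; rewrite -expr2 sqr_ge0.
have dot_eq0 n (u : 'rV[R]_n) : dot u u = 0 -> u = 0.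
  move=> /eqP; rewrite psumr_eq0 => [/allP u0|i _]; last by rewrite -expr2 sqr_ge0.
  apply/rowP => i; rewrite mxE; apply/eqP.
  by have := u0 i (mem_index_enum i); rewrite mulf_eq0 orbb.
apply: contraNT; rewrite -leNgt => g0.
have /andP[/eqP d1 /eqP d2] : (dot v.1 v.1 == 0) &&
    (dot (lambda c (val q.1) v.1 + v.2) (lambda c (val q.1) v.1 + v.2) == 0).
  by rewrite -paddr_eq0 // eq_le g0 addr_ge0.
move/dot_eq0: d1 d2 => v1 /dot_eq0; rewrite v1.
rewrite (_ : lambda _ _ 0 = 0) ?add0r => [v2|]; last first.
  by apply/rowP => i; rewrite !mxE /dot big1 // => j _; rewrite [X in _ * X]mxE mulr0.
by apply/eqP; rewrite [v]surjective_pairing v1 v2.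
Qed.

Lemma scal_eq (g : metric L) (s : S2xT2 L -> R) : is_scal g s -> scal g = s.
Proof.
move=> gs; have gs' : is_scal g (scal g) by exact: (getI gs).
by apply/funext => q; have [e [u <-]] := param_surj q; rewrite gs gs'.
Qed.

End Facts.

(* Main.v *)
Require Import Defs.
From mathcomp Require Import all_boot all_order all_algebra.
From mathcomp Require Import all_classical all_reals all_analysis.
From mathcomp Require Import ring lra.

(* In a chart, g_lambda is a Kaluza-Klein metric
   [phi |dx|^2 + sum_a (dz_a + sum_i A_ia dx_i)^2] with all coefficients
   independent of z.  Writing [d(sum_i A_ia dx_i) = phi b_a dx_0 /\ dx_1], its
   scalar curvature is that of [phi |dx|^2], here 2, minus [1/2 sum_a b_a^2].
   For the form attached to a traceless endomorphism c_a one finds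
   [b_a = +-3 <c_a p, p>], hence
   [scal = 2 - 9/2 (<c_0 p, p>^2 + <c_1 p, p>^2)], which is maximal exactly on
   the common zero locus of the two quadratic forms. *)

(** What separates [c] from [c'] is divisibility. For [c] the two quadratic forms are (p_3 -
    p_1)(p_3 + p_1) and 2 p_2 (p_1 + p_3), and their common linear factor cuts out a great circle.
    For [c'] they are p_3^2 - p_1^2 and 2 sqrt(2) p_1 p_3, which vanish together only where p_1 =
    p_3 = 0. The labour lies in the scalar curvature, given only as a coordinate expression with
    limits in four variables. The derivatives of phi, A and b are therefore named functions tied to
    them by [is_derive] hypotheses: curvature becomes rational in finitely many unknowns, and each
    component is an identity for [field]. Both stereographic charts are treated at once through the
    sign (-1)^e, which survives in b_a as a global sign and disappears on squaring. *)

Set Implicit Arguments.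
Unset Strict Implicit.
Unset Printing Implicit Defensive.

Import Order.TTheory GRing.Theory Num.Theory.
Import numFieldNormedType.Exports.

Local Open Scope classical_set_scope.
Local Open Scope ring_scope.

(** * Partial derivatives in product coordinates *)

Section PointwiseDerivation.
Context {R : realType} {V : normedModType R}.
Implicit Types (f g : V -> R) (x v : V).

Lemma is_derive_addf f g x v df dg : is_derive x v f df -> is_derive x v g dg ->
  is_derive x v (fun y => f y + g y) (df + dg).
Proof. exact: is_deriveD. Qed.

Lemma is_derive_oppf f x v df : is_derive x v f df ->
  is_derive x v (fun y => - f y) (- df).
Proof. exact: is_deriveN. Qed.

Lemma is_derive_mulf f g x v df dg : is_derive x v f df -> is_derive x v g dg ->
  is_derive x v (fun y => f y * g y) (f x * dg + g x * df).
Proof. exact: is_deriveM. Qed.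

Lemma is_derive_cstf (c : R) x v : is_derive x v (fun=> c) 0.
Proof. exact: is_derive_cst. Qed.

Lemma is_derive_expf f n x v df : is_derive x v f df ->
  is_derive x v (fun y => f y ^+ n) (n%:R * f x ^+ n.-1 * df).
Proof. by rewrite -[fun y => _]exprfctE; exact: is_deriveX. Qed.

Lemma is_derive_invf f x v df : f x != 0 -> is_derive x v f df ->
  is_derive x v (fun y => (f y)^-1) (- (f x) ^- 2 * df).
Proof.
move=> fx0 [fd <-]; split; first exact: derivableV.
by rewrite deriveV.
Qed.

End PointwiseDerivation.

Lemma is_derive_coord {R : realType} n (j : 'I_n) (x v : 'rV[R]_n) :
  is_derive x v (fun y => y 0 j) (v 0 j).
Proof.
split; first exact/diff_derivable/differentiable_coord.
apply/cvg_lim => //; apply: cvg_near_cst; near=> h.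
have h0 : h != 0 by near: h; exact: nbhs_dnbhs_neq.
by rewrite /= !mxE addrK /GRing.scale /= mulKf.
Unshelve. all: by end_near. Qed.

(** Run under [is_derive_eq]: the rules assemble a derivative of their own, and the residual
    equation compares it with the closed form. [tac] goes first, so that known derivatives win over
    structural rules. *)
Ltac derive_rules_with tac := repeat first
  [ tac | apply: is_derive_cstf | apply: is_derive_coord
  | apply: is_derive_addf | apply: is_derive_oppf | apply: is_derive_mulf
  | apply: is_derive_expf ].
Ltac derive_rules := derive_rules_with fail.

Section Dim2.
Context {R : realType}.

Lemma sum2 (V : nmodType) (F : 'I_2 -> V) : \sum_i F i = F 0 + F 1.
Proof.
rewrite 2!big_ord_recl big_ord0 addr0.
by congr (F _ + F _); apply/val_inj.
Qed.

Lemma sum22 (V : nmodType) (F : 'I_(2 + 2) -> V) : \sum_i F i =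
  F (lshift 2 0) + F (lshift 2 1) + (F (rshift 2 0) + F (rshift 2 1)).
Proof. by rewrite big_split_ord !sum2. Qed.

Lemma ord2P (P : 'I_2 -> Prop) : P 0 -> P 1 -> forall i, P i.
Proof.
move=> P0 P1 [[|[|//]] i2].
- by rewrite (_ : Ordinal i2 = 0) //; apply/val_inj.
- by rewrite (_ : Ordinal i2 = 1) //; apply/val_inj.
Qed.

Definition kron (i j : 'I_2) : R := (i == j)%:R.
(** On two indices the difference j - i is the Levi-Civita symbol. *)
Definition eps (i j : 'I_2) : R := (j : nat)%:R - (i : nat)%:R.

Lemma kron_eps : ((kron 0 0 = 1) * (kron 0 1 = 0) * (kron 1 0 = 0) * (kron 1 1 = 1))
  * ((eps 0 0 = 0) * (eps 0 1 = 1) * (eps 1 0 = -1) * (eps 1 1 = 0)).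
Proof. by rewrite /kron /eps /= !subrr subr0 sub0r. Qed.

(** Equality of the difference quotients themselves transfers derivability and derivatives from the
    base to the chart without a chain rule. *)
Lemma growth_rate_lsubmx (W : normedModType R) i (F : 'rV[R]_2 -> W) (u : 'rV[R]_(2 + 2)) :
  (fun h : R => h^-1 *: (((fun v => F (lsubmx v)) \o shift u)
                           (h *: stdbasis (lshift 2 i)) - F (lsubmx u))) =
  (fun h => h^-1 *: ((F \o shift (lsubmx u)) (h *: stdbasis i) - F (lsubmx u))).
Proof.
apply/funext => h /=; congr (_ *: (F _ - _)); rewrite linearD linearZ /=; congr (_ *: _ + _).
by apply/rowP => j; rewrite !mxE /= eq_lshift.
Qed.

Lemma partial_lsubmx (W : normedModType R) i (F : 'rV[R]_2 -> W) (u : 'rV[R]_(2 + 2)) :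
  partial (lshift 2 i) (fun v => F (lsubmx v)) u = partial i F (lsubmx u).
Proof. by rewrite /partial /derive growth_rate_lsubmx. Qed.

Lemma is_derive_lsubmx (W : normedModType R) i (F : 'rV[R]_2 -> W) (u : 'rV[R]_(2 + 2)) dF :
  is_derive (lsubmx u) (stdbasis i) F dF ->
  is_derive u (stdbasis (lshift 2 i)) (fun v => F (lsubmx v)) dF.
Proof.
move=> [Fd <-]; split; last exact: partial_lsubmx.
by rewrite /derivable growth_rate_lsubmx.
Qed.

Lemma is_derive_lsubmx_rshift (W : normedModType R) a (F : 'rV[R]_2 -> W)
    (u : 'rV[R]_(2 + 2)) :
  is_derive u (stdbasis (rshift 2 a)) (fun v => F (lsubmx v)) 0.
Proof.
have E : (fun h : R => h^-1 *: (((fun v => F (lsubmx v)) \o shift u)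
    (h *: stdbasis (rshift 2 a)) - F (lsubmx u))) = cst 0.
  apply/funext => h /=; rewrite (_ : lsubmx (_ + _) = lsubmx u) ?subrr ?scaler0 //.
  by apply/rowP => j; rewrite !mxE /= eq_lrshift mulr0 add0r.
split; first by rewrite /derivable E; exact: is_cvg_cst.
by rewrite /derive E; exact: lim_cst.
Qed.

Lemma partial_lsubmx_rshift (W : normedModType R) a (F : 'rV[R]_2 -> W) (u : 'rV[R]_(2 + 2)) :
  partial (rshift 2 a) (fun v => F (lsubmx v)) u = 0.
Proof. by have [] := is_derive_lsubmx_rshift a F u. Qed.

End Dim2.

Section VectorValued.
Context {R : realType} {V : normedModType R}.

Lemma is_derive_pair (W1 W2 : normedModType R) (f : V -> W1) (g : V -> W2) x v df dg :
  is_derive x v f df -> is_derive x v g dg ->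
  is_derive x v (fun y => (f y, g y)) (df, dg).
Proof.
move=> [fd <-] [gd <-].
have fgc : (fun h : R => h^-1 *: (((fun y => (f y, g y)) \o shift x) (h *: v) - (f x, g x)))
    @ 0^' --> ('D_v f x, 'D_v g x).
  exact: cvg_pair fd gd.
split; first by apply/cvg_ex; exists ('D_v f x, 'D_v g x).
exact: cvg_lim fgc.
Qed.

Lemma is_derive_row n (f : V -> 'rV[R]_n) x v (df : 'rV[R]_n) :
  (forall j, is_derive x v (fun y => f y 0 j) (df 0 j)) -> is_derive x v f df.
Proof.
move=> fd; have fd' : derivable f x v.
  by apply/derivable_mxP => i j; rewrite ord1; have [] := fd j.
split=> //; rewrite derive_mx //; apply/rowP => j; rewrite mxE.
by have [] := fd j.
Qed.

End VectorValued.

(** * Curvature of Kaluza-Klein metrics *)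

Section KaluzaKlein.
Context {R : realType}.
Variables (phi : 'rV[R]_2 -> R) (psi : 'I_2 -> 'rV[R]_2 -> R)
  (dpsi : 'I_2 -> 'I_2 -> 'rV[R]_2 -> R)
  (A : 'I_2 -> 'I_2 -> 'rV[R]_2 -> R) (dA : 'I_2 -> 'I_2 -> 'I_2 -> 'rV[R]_2 -> R)
  (b : 'I_2 -> 'rV[R]_2 -> R) (db : 'I_2 -> 'I_2 -> 'rV[R]_2 -> R).

(* [A] is the connection form, [dA k i a] = d_k A_ia; [psi] is the gradient of
   [ln phi / 2], so that the Gaussian curvature of [phi |dx|^2] is
   [- div psi / phi]. *)
Hypothesis phi_neq0 : forall x, phi x != 0.
Hypothesis phiD : forall k x,
  is_derive x (stdbasis k) phi (2 * phi x * psi k x).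
Hypothesis psiD : forall k i x, is_derive x (stdbasis k) (psi i) (dpsi k i x).
Hypothesis AD : forall k i a x, is_derive x (stdbasis k) (A i a) (dA k i a x).
Hypothesis bD : forall k a x, is_derive x (stdbasis k) (b a) (db k a x).
Hypothesis curl_A : forall a x, dA 0 1 a x - dA 1 0 a x = phi x * b a x.
Hypothesis gauss_curvature1 : forall x, dpsi 0 0 x + dpsi 1 1 x = - phi x.

Definition kk_base i j x := phi x * kron i j + (A i 0 x * A j 0 x + A i 1 x * A j 1 x).

Definition kk_metric (x : 'rV[R]_2) : 'M[R]_(2 + 2) :=
  block_mx (\matrix_(i, j) kk_base i j x) (\matrix_(i, a) A i a x)
           (\matrix_(a, i) A i a x) 1%:M.

(** With the horizontal lifts H_i = d_i - sum_a A_ia d_a, which are orthogonal of squared length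
    phi, this is the tensor phi^-1 sum_i H_i (x) H_i + sum_a d_a (x) d_a. *)
Definition kk_inv (x : 'rV[R]_2) : 'M[R]_(2 + 2) :=
  block_mx (\matrix_(i, j) ((phi x)^-1 * kron i j))
           (\matrix_(i, a) - ((phi x)^-1 * A i a x))
           (\matrix_(a, i) - ((phi x)^-1 * A i a x))
           (\matrix_(a, c) (kron a c
             + (phi x)^-1 * (A 0 a x * A 0 c x + A 1 a x * A 1 c x))).

Lemma invmx_kk x : invmx (kk_metric x) = kk_inv x.
Proof.
have phi0 := phi_neq0 x.
suff E : kk_metric x *m kk_inv x = 1%:M.
  have [Gu _] := mulmx1_unit E.
  by rewrite -[LHS]mulmx1 -E mulmxA mulVmx ?mul1mx.
rewrite mulmx_block [RHS](@scalar_mx_block _ 2 2 1).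
by congr block_mx; apply/matrixP; apply: ord2P; apply: ord2P;
  rewrite ?mxE !sum2 !mxE /kk_base ?kron_eps /=; field.
Qed.

Local Notation pr := (@lsubmx R 1 2 2).
Local Notation G := (fun u => kk_metric (pr u)).

(* The Christoffel symbols: [gamma_base] for Gamma^k_ij, [gamma_mixed] for
   Gamma^k_ia, [gamma_fibre_mixed] for Gamma^c_ia and [gamma_fibre] for
   Gamma^c_ij, with i, j, k base and a, c fibre indices.  The hypothesis on the
   curl of [A] makes the first three polynomial in psi, b and A; the last one
   is never differentiated in a base direction in the Ricci tensor, so second
   derivatives of [A] do not occur. *)
Definition gamma_base k i j x : R :=
  psi i x * kron j k + psi j x * kron i k - psi k x * kron i j
  + 2^-1 * (b 0 x * (A j 0 x * eps i k + A i 0 x * eps j k)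
          + b 1 x * (A j 1 x * eps i k + A i 1 x * eps j k)).
Definition gamma_mixed k i a x : R := 2^-1 * b a x * eps i k.
Definition gamma_fibre_mixed c i a x : R :=
  - (A 0 c x * gamma_mixed 0 i a x + A 1 c x * gamma_mixed 1 i a x).
Definition gamma_fibre c i j x : R := 2^-1 * (dA i j c x + dA j i c x)
  - (A 0 c x * gamma_base 0 i j x + A 1 c x * gamma_base 1 i j x).

Definition dkk_base k i j x : R := 2 * phi x * psi k x * kron i j
  + (dA k i 0 x * A j 0 x + A i 0 x * dA k j 0 x
    + (dA k i 1 x * A j 1 x + A i 1 x * dA k j 1 x)).

Lemma kk_baseD k i j x :
  is_derive x (stdbasis k) (kk_base i j) (dkk_base k i j x).
Proof.
apply: is_derive_eq; rewrite /kk_base; derive_rules.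
by rewrite /dkk_base /GRing.scale /=; ring.
Qed.

Lemma kk_metric_ll i j : (fun u => G u (lshift 2 i) (lshift 2 j)) =
  fun u => kk_base i j (pr u).
Proof. by apply/funext => u; rewrite block_mxEul mxE. Qed.
Lemma kk_metric_lr i j : (fun u => G u (lshift 2 i) (rshift 2 j)) =
  fun u => A i j (pr u).
Proof. by apply/funext => u; rewrite block_mxEur mxE. Qed.
Lemma kk_metric_rl i j : (fun u => G u (rshift 2 i) (lshift 2 j)) =
  fun u => A j i (pr u).
Proof. by apply/funext => u; rewrite block_mxEdl mxE. Qed.
Lemma kk_metric_rr i j : (fun u => G u (rshift 2 i) (rshift 2 j)) =
  fun=> kron i j.
Proof. by apply/funext => u; rewrite block_mxEdr mxE. Qed.

Lemma partial_kk_base k i j x : partial k (kk_base i j) x = dkk_base k i j x.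
Proof. by have [] := kk_baseD k i j x. Qed.
Lemma partial_A k i a x : partial k (A i a) x = dA k i a x.
Proof. by have [] := AD k i a x. Qed.
Lemma partial_cst n k (r : R) (x : 'rV[R]_n) : partial k (fun=> r) x = 0.
Proof. exact: derive_cst. Qed.

Let kkE := (kk_metric_ll, kk_metric_lr, kk_metric_rl, kk_metric_rr,
  @partial_lsubmx R, @partial_lsubmx_rshift R, partial_kk_base, partial_A, partial_cst).

(** Eliminates [dA 0 1 a], after which [field] may treat the remaining derivatives as independent
    unknowns. *)
Lemma curl_AE a x : dA 0 1 a x = dA 1 0 a x + phi x * b a x.
Proof. by rewrite -curl_A; ring. Qed.

Ltac christoffel_tac :=
  let u := fresh "u" in let x := fresh "x" in let phi0 := fresh "phi0" in
  rewrite /christoffel; apply/funext => u /=; rewrite sum22 invmx_kk;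
  rewrite !kkE ?block_mxEul ?block_mxEur ?block_mxEdl ?block_mxEdr !mxE;
  move: (lsubmx u) => x; have phi0 := phi_neq0 x.

Lemma christoffel_lll k i j :
  christoffel G (lshift 2 k) (lshift 2 i) (lshift 2 j) = fun u => gamma_base k i j (pr u).
Proof.
christoffel_tac.
move: k i j; apply: ord2P; apply: ord2P; apply: ord2P;
by rewrite /dkk_base /gamma_base !kron_eps ?curl_AE; field.
Qed.

Lemma christoffel_llr k i a :
  christoffel G (lshift 2 k) (lshift 2 i) (rshift 2 a) = fun u => gamma_mixed k i a (pr u).
Proof.
christoffel_tac.
move: k i a; apply: ord2P; apply: ord2P; apply: ord2P;
by rewrite /gamma_mixed !kron_eps ?curl_AE; field.
Qed.

Lemma christoffel_lrl k i a :
  christoffel G (lshift 2 k) (rshift 2 a) (lshift 2 i) = fun u => gamma_mixed k i a (pr u).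
Proof.
christoffel_tac.
move: k i a; apply: ord2P; apply: ord2P; apply: ord2P;
by rewrite /gamma_mixed !kron_eps ?curl_AE; field.
Qed.

Lemma christoffel_lrr k a c :
  christoffel G (lshift 2 k) (rshift 2 a) (rshift 2 c) = fun=> 0.
Proof. by christoffel_tac; ring. Qed.

Lemma christoffel_rll c i j :
  christoffel G (rshift 2 c) (lshift 2 i) (lshift 2 j) = fun u => gamma_fibre c i j (pr u).
Proof.
christoffel_tac.
move: c i j; apply: ord2P; apply: ord2P; apply: ord2P;
by rewrite /dkk_base /gamma_fibre /gamma_base !kron_eps ?curl_AE; field.
Qed.

Lemma christoffel_rlr c i a :
  christoffel G (rshift 2 c) (lshift 2 i) (rshift 2 a) =
  fun u => gamma_fibre_mixed c i a (pr u).
Proof.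
christoffel_tac.
move: c i a; apply: ord2P; apply: ord2P; apply: ord2P;
by rewrite /gamma_fibre_mixed /gamma_mixed !kron_eps ?curl_AE; field.
Qed.

Lemma christoffel_rrl c i a :
  christoffel G (rshift 2 c) (rshift 2 a) (lshift 2 i) =
  fun u => gamma_fibre_mixed c i a (pr u).
Proof.
christoffel_tac.
move: c i a; apply: ord2P; apply: ord2P; apply: ord2P;
by rewrite /gamma_fibre_mixed /gamma_mixed !kron_eps ?curl_AE; field.
Qed.

Lemma christoffel_rrr c a d :
  christoffel G (rshift 2 c) (rshift 2 a) (rshift 2 d) = fun=> 0.
Proof. by christoffel_tac; ring. Qed.

Let christoffelE := (christoffel_lll, christoffel_llr, christoffel_lrl,
  christoffel_lrr, christoffel_rll, christoffel_rlr, christoffel_rrl, christoffel_rrr).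

Definition dgamma_base m k i j x : R :=
  dpsi m i x * kron j k + dpsi m j x * kron i k - dpsi m k x * kron i j
  + 2^-1 * (db m 0 x * (A j 0 x * eps i k + A i 0 x * eps j k)
          + b 0 x * (dA m j 0 x * eps i k + dA m i 0 x * eps j k)
          + db m 1 x * (A j 1 x * eps i k + A i 1 x * eps j k)
          + b 1 x * (dA m j 1 x * eps i k + dA m i 1 x * eps j k)).
Definition dgamma_mixed m k i a x : R := 2^-1 * db m a x * eps i k.
Definition dgamma_fibre_mixed m c i a x : R :=
  - (dA m 0 c x * gamma_mixed 0 i a x + A 0 c x * dgamma_mixed m 0 i a x
     + dA m 1 c x * gamma_mixed 1 i a x + A 1 c x * dgamma_mixed m 1 i a x).

Lemma partial_gamma_base m k i j x : partial m (gamma_base k i j) x = dgamma_base m k i j x.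
Proof.
apply: derive_val; apply: is_derive_eq; rewrite /gamma_base; derive_rules.
by rewrite /dgamma_base /GRing.scale /=; ring.
Qed.

Lemma partial_gamma_mixed m k i a x : partial m (gamma_mixed k i a) x = dgamma_mixed m k i a x.
Proof.
apply: derive_val; apply: is_derive_eq; rewrite /gamma_mixed; derive_rules.
by rewrite /dgamma_mixed /GRing.scale /=; ring.
Qed.

Lemma partial_gamma_fibre_mixed m c i a x :
  partial m (gamma_fibre_mixed c i a) x = dgamma_fibre_mixed m c i a x.
Proof.
apply: derive_val; apply: is_derive_eq; rewrite /gamma_fibre_mixed /gamma_mixed; derive_rules.
by rewrite /dgamma_fibre_mixed /dgamma_mixed /gamma_mixed /GRing.scale /=; ring.
Qed.

Lemma dpsi00E x : dpsi 0 0 x = - phi x - dpsi 1 1 x.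
Proof. by rewrite -gauss_curvature1; ring. Qed.

Ltac ricci_tac :=
  rewrite /ricci sum22 /riemann !sum22 !christoffelE ?partial_lsubmx
    ?partial_lsubmx_rshift ?(partial_gamma_base, partial_gamma_mixed,
      partial_gamma_fibre_mixed, partial_cst);
  move: (lsubmx _) => x.

(** This is Ric(H_i, d_a) for the horizontal lift H_i: up to sign half the divergence of the
    curvature form, a rotated gradient of b_a. *)
Definition curl_b i a x : R := 2^-1 * (eps i 0 * db 0 a x + eps i 1 * db 1 a x).
Definition dot_Ab i x : R := A i 0 x * b 0 x + A i 1 x * b 1 x.

(** The fibres are flat and totally geodesic, so only 1/4 of the contracted curvature forms remains;
    the index pairs (0,1) and (1,0) contribute equally, whence 1/2. *)
Lemma ricci_rr a c u :
  ricci G (rshift 2 a) (rshift 2 c) u = 2^-1 * b a (pr u) * b c (pr u).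
Proof.
ricci_tac.
by rewrite /dgamma_fibre_mixed /dgamma_mixed /gamma_fibre_mixed /gamma_mixed
  !kron_eps ?curl_AE; field.
Qed.

(** Substituting d_i = H_i + sum_a A_ia d_a splits this into Ric(H_i, d_c) and a multiple of the
    fibre components. *)
Lemma ricci_lr i c u :
  ricci G (lshift 2 i) (rshift 2 c) u =
  curl_b i c (pr u) + 2^-1 * dot_Ab i (pr u) * b c (pr u).
Proof.
ricci_tac.
move: i c; apply: ord2P; apply: ord2P;
by rewrite /curl_b /dot_Ab /dgamma_fibre_mixed /dgamma_mixed /gamma_fibre_mixed
  /gamma_mixed /gamma_base /dgamma_base !kron_eps ?curl_AE; field.
Qed.

Lemma ricci_rl i c u :
  ricci G (rshift 2 c) (lshift 2 i) u =
  curl_b i c (pr u) + 2^-1 * dot_Ab i (pr u) * b c (pr u).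
Proof.
ricci_tac.
move: i c; apply: ord2P; apply: ord2P;
by rewrite /curl_b /dot_Ab /dgamma_fibre_mixed /dgamma_mixed /gamma_fibre_mixed
  /gamma_mixed /gamma_base /dgamma_base !kron_eps ?curl_AE; field.
Qed.

(** The same splitting in both slots; the first term is Ric(H_i, H_i), its 1 being the Gaussian
    curvature. Diagonal entries suffice, since the base block of [kk_inv] is diagonal. *)
Lemma ricci_ll i u : ricci G (lshift 2 i) (lshift 2 i) u =
  phi (pr u) * (1 - 2^-1 * (b 0 (pr u) ^+ 2 + b 1 (pr u) ^+ 2))
  + 2 * (A i 0 (pr u) * curl_b i 0 (pr u) + A i 1 (pr u) * curl_b i 1 (pr u))
  + 2^-1 * dot_Ab i (pr u) ^+ 2.
Proof.
ricci_tac.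
move: i; apply: ord2P;
by rewrite /curl_b /dot_Ab /dgamma_fibre_mixed /dgamma_mixed /gamma_fibre_mixed
  /gamma_mixed /gamma_fibre /gamma_base /dgamma_base !kron_eps ?curl_AE ?dpsi00E; field.
Qed.

(** In the adapted frame the base contributes 2 - (b_0^2 + b_1^2) and the fibres (b_0^2 + b_1^2) /
    2; the [curl_b] terms are off-diagonal there and cancel. *)
Lemma scal_kk u : scal_coord G u = 2 - 2^-1 * (b 0 (pr u) ^+ 2 + b 1 (pr u) ^+ 2).
Proof.
rewrite /scal_coord !sum22 invmx_kk.
rewrite !(block_mxEul, block_mxEur, block_mxEdl, block_mxEdr) !mxE !kron_eps.
rewrite !ricci_rr !ricci_rl !ricci_lr !ricci_ll /curl_b /dot_Ab !kron_eps.
by move: (phi_neq0 (pr u)); move: (lsubmx _) => x phi0; field.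
Qed.

End KaluzaKlein.

(** * Stereographic charts *)

Section Dim3.
Context {R : realType}.

Lemma sum3 (V : nmodType) (F : 'I_3 -> V) : \sum_i F i = F 0 + F 1 + F 2%:R.
Proof.
rewrite 3!big_ord_recl big_ord0 addr0 addrA.
by congr (F _ + F _ + F _); apply/val_inj.
Qed.

Lemma ord3P (P : 'I_3 -> Prop) : P 0 -> P 1 -> P 2%:R -> forall i, P i.
Proof.
move=> P0 P1 P2 [[|[|[|//]]] i3].
- by rewrite (_ : Ordinal i3 = 0) //; apply/val_inj.
- by rewrite (_ : Ordinal i3 = 1) //; apply/val_inj.
- by rewrite (_ : Ordinal i3 = 2%:R) //; apply/val_inj.
Qed.

Definition matvec (M : 'M[R]_3) (f : 'I_3 -> R) (i : 'I_3) : R :=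
  M i 0 * f 0 + M i 1 * f 1 + M i 2%:R * f 2%:R.

Definition dot3 (f g : 'I_3 -> R) : R := f 0 * g 0 + f 1 * g 1 + f 2%:R * g 2%:R.

Definition det3 (f g h : 'I_3 -> R) : R :=
  (f 1 * g 2%:R - f 2%:R * g 1) * h 0 + (f 2%:R * g 0 - f 0 * g 2%:R) * h 1
  + (f 0 * g 1 - f 1 * g 0) * h 2%:R.

(** The infinitesimal form of det(exp(tM)) = exp(t tr M): letting M act on one slot at a time
    multiplies the determinant by tr M. *)
Lemma det3_traceless (M : 'M[R]_3) (f g h : 'I_3 -> R) : \tr M = 0 ->
  det3 (matvec M f) g h + det3 f (matvec M g) h + det3 f g (matvec M h) = 0.
Proof.
rewrite /mxtrace sum3 => trM.
transitivity ((M 0 0 + M 1 1 + M 2%:R 2%:R) * det3 f g h); last by rewrite trM mul0r.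
by rewrite /det3 /matvec; ring.
Qed.

End Dim3.

Section StereoCalculus.
Context {R : realType}.
Variable (e : bool).
Implicit Type x : 'rV[R]_2.

Let s : R := (-1) ^+ e.

(* [stereo e x] has coordinates [stereo_scale x * stereo_num j x]; a prefix [d]
   (resp. [dd]) denotes first (resp. second) partial derivatives, the indices
   of differentiation coming first. *)
Definition stereo_scale x : R := (1 + (x 0 0 * x 0 0 + x 0 1 * x 0 1))^-1.
Definition dstereo_scale k x : R := - (2 * x 0 k * stereo_scale x ^+ 2).
Definition ddstereo_scale l k x : R :=
  - (2 * kron l k * stereo_scale x ^+ 2) + 8 * x 0 k * x 0 l * stereo_scale x ^+ 3.

Definition stereo_num (j : 'I_3) x : R :=
  [:: 2 * x 0 0; 2 * x 0 1; s * (x 0 0 * x 0 0 + x 0 1 * x 0 1 - 1)]`_j.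
Definition dstereo_num k (j : 'I_3) x : R :=
  [:: 2 * kron k 0; 2 * kron k 1; s * (2 * x 0 k)]`_j.
Definition ddstereo_num l k (j : 'I_3) : R := [:: 0; 0; s * (2 * kron l k)]`_j.

Definition stereo_coord j x : R := stereo_scale x * stereo_num j x.
Definition dstereo k j x : R :=
  dstereo_scale k x * stereo_num j x + stereo_scale x * dstereo_num k j x.
Definition ddstereo l k j x : R :=
  ddstereo_scale l k x * stereo_num j x + dstereo_scale k x * dstereo_num l j x
  + dstereo_scale l x * dstereo_num k j x
  + stereo_scale x * ddstereo_num l k j.

Lemma stereo_den_neq0 x : 1 + (x 0 0 * x 0 0 + x 0 1 * x 0 1) != 0.
Proof. by rewrite gt_eqF // ltr_pwDl // addr_ge0 // -expr2 sqr_ge0. Qed.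

Lemma stereoE x j : stereo e x 0 j = stereo_coord j x.
Proof.
rewrite /stereo /stereo_coord /stereo_scale /dot sum2 mxE; congr (_ * _).
by move: j; apply: ord3P; rewrite mxE.
Qed.

Lemma kronE i k : stdbasis i 0 k = kron i k :> R.
Proof. by rewrite mxE eqxx /= /kron eq_sym. Qed.

Lemma is_derive_coord2 k i x : is_derive x (stdbasis k) (fun y => y 0 i) (kron k i).
Proof. by rewrite -kronE; exact: is_derive_coord. Qed.

Lemma stereo_scaleD k x : is_derive x (stdbasis k) stereo_scale (dstereo_scale k x).
Proof.
apply: is_derive_eq.
  apply: is_derive_invf; first exact: stereo_den_neq0.
  by derive_rules; exact: is_derive_coord2.
rewrite /dstereo_scale /stereo_scale /GRing.scale /=.
by move: k; apply: ord2P; rewrite ?kronE ?kron_eps; field; exact: stereo_den_neq0.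
Qed.

Lemma dstereo_scaleD l k x : is_derive x (stdbasis l) (dstereo_scale k) (ddstereo_scale l k x).
Proof.
apply: is_derive_eq.
  by rewrite /dstereo_scale; derive_rules; exact: stereo_scaleD.
rewrite /ddstereo_scale /dstereo_scale /GRing.scale /=.
by move: l k; apply: ord2P; apply: ord2P; rewrite ?kronE ?kron_eps; ring.
Qed.

Lemma stereo_numD k j x : is_derive x (stdbasis k) (stereo_num j) (dstereo_num k j x).
Proof.
move: j; apply: ord3P; (apply: is_derive_eq; first by rewrite /stereo_num /=; derive_rules);
  rewrite /dstereo_num /GRing.scale /=;
  by move: k; apply: ord2P; rewrite ?kronE ?kron_eps; ring.
Qed.

Lemma dstereo_numD l k j x : is_derive x (stdbasis l) (dstereo_num k j) (ddstereo_num l k j).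
Proof.
move: j; apply: ord3P; (apply: is_derive_eq; rewrite ?/dstereo_num /=; derive_rules);
  rewrite /ddstereo_num /GRing.scale /=;
  by move: l k; apply: ord2P; apply: ord2P; rewrite ?kronE ?kron_eps; ring.
Qed.

Lemma stereo_coordD k j x : is_derive x (stdbasis k) (stereo_coord j) (dstereo k j x).
Proof.
apply: is_derive_eq.
  by apply: is_derive_mulf; [exact: stereo_scaleD | exact: stereo_numD].
by rewrite /dstereo; ring.
Qed.

Lemma dstereoD l k j x : is_derive x (stdbasis l) (dstereo k j) (ddstereo l k j x).
Proof.
apply: is_derive_eq.
  rewrite /dstereo; apply: is_derive_addf; apply: is_derive_mulf;
    first [exact: stereo_scaleD | exact: dstereo_scaleD | exact: stereo_numD
      | exact: dstereo_numD].
by rewrite /ddstereo; ring.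
Qed.

Definition stereo_conf x : R := 4 * stereo_scale x ^+ 2.
Definition stereo_dlog i x : R := - (2 * x 0 i * stereo_scale x).
Definition dstereo_dlog k i x : R :=
  - (2 * kron k i * stereo_scale x) + 4 * x 0 i * x 0 k * stereo_scale x ^+ 2.

Lemma stereo_conf_neq0 x : stereo_conf x != 0.
Proof. by rewrite mulf_neq0 ?pnatr_eq0 // expf_neq0 // invr_eq0 stereo_den_neq0. Qed.

Lemma stereo_confD k x : is_derive x (stdbasis k) stereo_conf (2 * stereo_conf x * stereo_dlog k x).
Proof.
apply: is_derive_eq.
  by rewrite /stereo_conf; derive_rules; exact: stereo_scaleD.
by rewrite /stereo_conf /stereo_dlog /dstereo_scale /GRing.scale /=; ring.
Qed.

Lemma stereo_dlogD k i x : is_derive x (stdbasis k) (stereo_dlog i) (dstereo_dlog k i x).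
Proof.
apply: is_derive_eq.
  by rewrite /stereo_dlog; derive_rules; exact: stereo_scaleD.
by rewrite /stereo_dlog /dstereo_dlog /dstereo_scale /GRing.scale /= !kronE; ring.
Qed.

(** Gaussian curvature 1 of the round sphere, [stereo_dlog] being the gradient of half the logarithm
    of [stereo_conf]. *)
Lemma stereo_dlog_div x : dstereo_dlog 0 0 x + dstereo_dlog 1 1 x = - stereo_conf x.
Proof.
by rewrite /dstereo_dlog /stereo_conf /stereo_scale !kron_eps; field; exact: stereo_den_neq0.
Qed.

Lemma signr_cases : s = 1 \/ s = -1.
Proof. by rewrite /s; case: (e); [right | left]. Qed.

Lemma dstereo_conformal i j x : dot3 (dstereo i ^~ x) (dstereo j ^~ x) = stereo_conf x * kron i j.
Proof.
rewrite /dot3 /dstereo /stereo_num /dstereo_num /= /dstereo_scale /stereo_conf /stereo_scale.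
have [-> | ->] := signr_cases; move: i j; apply: ord2P; apply: ord2P;
  rewrite !kron_eps; by field; exact: stereo_den_neq0.
Qed.

Lemma ddstereo_sym l k j x : ddstereo l k j x = ddstereo k l j x.
Proof.
rewrite /ddstereo /ddstereo_scale /ddstereo_num /kron [l == k]eq_sym.
by move: j; apply: ord3P => /=; ring.
Qed.

(** The tangent vectors d_0 p and d_1 p are orthogonal with squared length [stereo_conf x], so their
    cross product is that multiple of the normal p up to sign; the sign depends on the projection
    pole. *)
Lemma det3_dstereo (f : 'I_3 -> R) x :
  det3 f (dstereo 0 ^~ x) (dstereo 1 ^~ x) = - s * stereo_conf x * dot3 f (stereo_coord ^~ x).
Proof.
rewrite /det3 /dot3 /stereo_coord /dstereo /stereo_num /dstereo_num /=
  /dstereo_scale /stereo_conf /stereo_scale.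
have [-> | ->] := signr_cases; rewrite !kron_eps; by field; exact: stereo_den_neq0.
Qed.

End StereoCalculus.

(** * The connection form in stereographic charts and its curvature *)

Section Connection.
Context {R : realType}.
Variables (e : bool) (M : 'M[R]_3).
Hypothesis trM : \tr M = 0.
Implicit Type x : 'rV[R]_2.

Definition stereo_conn i x : R :=
  det3 (matvec M (stereo_coord e ^~ x)) (stereo_coord e ^~ x) (dstereo e i ^~ x).
Definition dstereo_conn k i x : R :=
  det3 (matvec M (dstereo e k ^~ x)) (stereo_coord e ^~ x) (dstereo e i ^~ x)
  + det3 (matvec M (stereo_coord e ^~ x)) (dstereo e k ^~ x) (dstereo e i ^~ x)
  + det3 (matvec M (stereo_coord e ^~ x)) (stereo_coord e ^~ x) (ddstereo e k i ^~ x).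
(* The sign comes from the chart: [d_0 p x d_1 p] is [- (-1)^e phi p]. *)
Definition stereo_curv x : R :=
  - (3 * (-1) ^+ e * dot3 (matvec M (stereo_coord e ^~ x)) (stereo_coord e ^~ x)).
Definition dstereo_curv k x : R := - (3 * (-1) ^+ e *
  (dot3 (matvec M (dstereo e k ^~ x)) (stereo_coord e ^~ x)
   + dot3 (matvec M (stereo_coord e ^~ x)) (dstereo e k ^~ x))).

Lemma stereo_connD k i x : is_derive x (stdbasis k) (stereo_conn i) (dstereo_conn k i x).
Proof.
apply: is_derive_eq.
  by rewrite /stereo_conn /det3 /matvec;
    derive_rules_with ltac:(first [exact: stereo_coordD | exact: dstereoD]).
by rewrite /dstereo_conn /det3 /matvec /GRing.scale /=; ring.
Qed.

Lemma stereo_curvD k x : is_derive x (stdbasis k) stereo_curv (dstereo_curv k x).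
Proof.
apply: is_derive_eq.
  by rewrite /stereo_curv /dot3 /matvec; derive_rules_with ltac:(exact: stereo_coordD).
by rewrite /dstereo_curv /dot3 /matvec /GRing.scale /=; ring.
Qed.

(* With [V_i = d_i p], the symmetric second derivatives cancel in the curl of
   [det(M p, p, V_i)], leaving
   [2 det(M p, V_0, V_1) + det(M V_0, p, V_1) - det(M V_1, p, V_0)]; as [M] is
   traceless the last two terms add up to a third [det(M p, V_0, V_1)]. *)
Lemma curl_stereo_conn x : dstereo_conn 0 1 x - dstereo_conn 1 0 x = stereo_conf x * stereo_curv x.
Proof.
have E : det3 (matvec M (stereo_coord e ^~ x)) (dstereo e 0 ^~ x) (dstereo e 1 ^~ x) =
    - (-1) ^+ e * stereo_conf x * dot3 (matvec M (stereo_coord e ^~ x)) (stereo_coord e ^~ x).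
  exact: det3_dstereo.
have T := det3_traceless (stereo_coord e ^~ x) (dstereo e 0 ^~ x) (dstereo e 1 ^~ x) trM.
transitivity (3 * det3 (matvec M (stereo_coord e ^~ x)) (dstereo e 0 ^~ x) (dstereo e 1 ^~ x));
  last by rewrite E /stereo_curv; ring.
rewrite -[LHS]addr0 -{}[in LHS]T /dstereo_conn.
rewrite (_ : (ddstereo e 1 0)^~ x = (ddstereo e 0 1)^~ x); last first.
  by apply/funext => j; exact: ddstereo_sym.
by rewrite /det3; ring.
Qed.

End Connection.

(** * The scalar curvature of g_lambda *)

Section ScalarCurvature.
Context {R : realType} (L : lattice R) (c : {linear 'rV[R]_2 -> S0 R 3}).

Lemma dotE3 (u v : 'rV[R]_3) : dot u v = dot3 (u 0) (v 0).
Proof. by rewrite /dot sum3. Qed.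

Lemma dot_crossmul (u v w : 'rV[R]_3) : dot (crossmul u v) w = det3 (u 0) (v 0) (w 0).
Proof. by rewrite dotE3 /dot3 !mxE. Qed.

Lemma mxactE (M : 'M[R]_3) p : mxact M p 0 = matvec M (p 0).
Proof. by apply/funext => i; rewrite !mxE sum3 !mxE. Qed.

Lemma S0_trace n (M : S0 R n) : \tr M = 0.
Proof. by have /andP[_ /eqP] := valP M. Qed.

Lemma stereo_fun e (x : 'rV[R]_2) : stereo e x 0 = stereo_coord e ^~ x.
Proof. by apply/funext => j; exact: stereoE. Qed.

Let M a := S0mx (c (stdbasis a)).

Lemma partial_param_lift_lshift e i (u : 'rV[R]_(2 + 2)) :
  partial (lshift 2 i) (param_lift e) u = (\row_j dstereo e i j (lsubmx u), 0).
Proof.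
apply: derive_val; apply: is_derive_pair.
  apply: is_derive_lsubmx; apply: is_derive_row => j; rewrite mxE.
  rewrite (_ : (fun y => _) = stereo_coord e j); first exact: stereo_coordD.
  by apply/funext => x; exact: stereoE.
apply: is_derive_row => j; rewrite mxE.
rewrite (_ : (fun y => _) = fun y : 'rV_(2 + 2) => y 0 (rshift 2 j)); last first.
  by apply/funext => y; rewrite mxE.
by apply: is_derive_eq; first exact: is_derive_coord; rewrite mxE eq_rlshift andbF.
Qed.

Lemma partial_param_lift_rshift e a (u : 'rV[R]_(2 + 2)) :
  partial (rshift 2 a) (param_lift e) u = (0, stdbasis a).
Proof.
apply: derive_val; apply: is_derive_pair; first exact: is_derive_lsubmx_rshift.
apply: is_derive_row => j.
rewrite (_ : (fun y => _) = fun y : 'rV_(2 + 2) => y 0 (rshift 2 j)); last first.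
  by apply/funext => y; rewrite mxE.
by apply: is_derive_eq; first exact: is_derive_coord; rewrite !mxE eq_rshift.
Qed.

Lemma lambda_dstereo e i (x : 'rV[R]_2) :
  lambda c (stereo e x) (\row_j dstereo e i j x) = \row_a stereo_conn e (M a) i x.
Proof.
apply/rowP => a; rewrite !mxE dot_crossmul mxactE stereo_fun /stereo_conn; congr det3.
by apply/funext => j; rewrite mxE.
Qed.

Lemma lambda0r p : lambda c p 0 = 0.
Proof. by apply/rowP => a; rewrite !mxE /dot big1 // => j _; rewrite [X in _ * X]mxE mulr0. Qed.

Lemma local_metric_kk e (u : 'rV[R]_(2 + 2)) :
  local_metric (g_lambda (L := L) c) e u =
  kk_metric stereo_conf (fun i a => stereo_conn e (M a) i) (lsubmx u).
Proof.
apply/matrixP => i j; rewrite mxE /g_lambda /=.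
rewrite -(splitK i) -(splitK j); case: (fintype.split i) => {}i;
  case: (fintype.split j) => {}j /=;
  rewrite ?partial_param_lift_lshift ?partial_param_lift_rshift /=
    ?lambda_dstereo ?lambda0r ?addr0 ?add0r /kk_metric
    ?block_mxEul ?block_mxEur ?block_mxEdl ?block_mxEdr [RHS]mxE.
- rewrite /kk_base -(dstereo_conformal e) dotE3 /dot sum2 !mxE; congr (_ + _).
  by rewrite /dot3 !mxE.
- rewrite /dot sum2 big1 => [|k _]; last by rewrite [X in _ * X]mxE mulr0.
  by move: j; apply: ord2P; rewrite !mxE /=; ring.
- rewrite /dot sum2 big1 => [|k _]; last by rewrite [X in X * _]mxE mul0r.
  by move: i; apply: ord2P; rewrite !mxE /=; ring.
- rewrite /dot sum2 big1 => [|k _]; last by rewrite [X in X * _]mxE mul0r.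
  by move: i j; apply: ord2P; apply: ord2P; rewrite !mxE /=; ring.
Qed.

Definition quad a (p : 'rV[R]_3) : R := dot (mxact (M a) p) p.

Definition scalf (q : S2xT2 L) : R :=
  2 - 9 / 2 * (quad 0 (val q.1) ^+ 2 + quad 1 (val q.1) ^+ 2).

Lemma scal_g_lambda : scal (g_lambda (L := L) c) = scalf.
Proof.
(* [scal] is a choice among the functions satisfying [is_scal]; uniqueness reduces the claim to
   checking [scalf] in both charts. *)
apply: scal_eq => e u.
rewrite (_ : local_metric _ e =
  fun u => kk_metric stereo_conf (fun i a => stereo_conn e (M a) i) (lsubmx u)); last first.
  by apply/funext => v; exact: local_metric_kk.
have AD k i a x :
    is_derive x (stdbasis k) (stereo_conn e (M a) i) (dstereo_conn e (M a) k i x).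
  exact: stereo_connD.
have bD k a x : is_derive x (stdbasis k) (stereo_curv e (M a)) (dstereo_curv e (M a) k x).
  exact: stereo_curvD.
have curl a x : dstereo_conn e (M a) 0 1 x - dstereo_conn e (M a) 1 0 x =
    stereo_conf x * stereo_curv e (M a) x.
  by apply: curl_stereo_conn; exact: S0_trace.
rewrite (scal_kk (@stereo_conf_neq0 R) (@stereo_confD R) (@stereo_dlogD R) AD bD curl
  (@stereo_dlog_div R)).
rewrite /scalf /quad /stereo_curv /= !dotE3 !mxactE !stereo_fun.
(* The chart sign is squared away, and 3^2 / 2 gives the constant 9 / 2. *)
by have [-> | ->] := @signr_cases R e; field.
Qed.

End ScalarCurvature.

(** * Polynomial submanifolds *)

Section PolynomialFunctions.
Context {R : realType} {n : nat}.
Implicit Types (f g : 'rV[R]_n -> R) (U : set 'rV[R]_n).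

(** A class closed under [partial], so smoothness of every order follows by induction. Subtraction
    is no constructor, hence forms such as [+ -1] in the equations below. *)
Inductive poly_fun : ('rV[R]_n -> R) -> Prop :=
| PolyCst r : poly_fun (fun=> r)
| PolyCoord j : poly_fun (fun x => x 0 j)
| PolyAdd f g : poly_fun f -> poly_fun g -> poly_fun (fun x => f x + g x)
| PolyMul f g : poly_fun f -> poly_fun g -> poly_fun (fun x => f x * g x).

Lemma poly_fun_differentiable f x : poly_fun f -> differentiable f x.
Proof.
elim=> [r|j|{}f g _ df _ dg|{}f g _ df _ dg].
- exact: differentiable_cst.
- exact: differentiable_coord.
- exact: differentiableD.
- exact: differentiableM.
Qed.

Lemma poly_fun_partial i f : poly_fun f -> poly_fun (partial i f).
Proof.
have d h x : poly_fun h -> is_derive x (stdbasis i) h (partial i h x).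
  by move=> /(poly_fun_differentiable x) ?; apply/derivableP/diff_derivable.
elim=> [r|j|{}f g Pf Pdf Pg Pdg|{}f g Pf Pdf Pg Pdg].
- rewrite (_ : partial i _ = fun=> 0); first exact: PolyCst.
  by apply/funext => x; exact: derive_cst.
- rewrite (_ : partial i _ = fun=> stdbasis i 0 j); first exact: PolyCst.
  by apply/funext => x; apply: derive_val; exact: is_derive_coord.
- rewrite (_ : partial i _ = fun x => partial i f x + partial i g x).
    exact: PolyAdd.
  by apply/funext => x; apply: derive_val; apply: is_derive_addf; exact: d.
- rewrite (_ : partial i _ = fun x => f x * partial i g x + g x * partial i f x).
    by apply: PolyAdd; exact: PolyMul.
  by apply/funext => x; apply: derive_val; apply: is_derive_mulf; exact: d.
Qed.

Lemma poly_fun_Ck r U f : poly_fun f -> Ck_on r U f.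
Proof.
elim: r f => [|r IH] f Pf /=.
  by move=> x _; exact/differentiable_continuous/poly_fun_differentiable.
move=> i; split=> [x _|]; first exact/diff_derivable/poly_fun_differentiable.
exact/IH/poly_fun_partial.
Qed.

Definition poly_map k (F : 'rV[R]_n -> 'rV[R]_k) : Prop :=
  forall j, poly_fun (fun x => F x 0 j).

Lemma poly_map_smooth k (F : 'rV[R]_n -> 'rV[R]_k) U : poly_map F -> smooth_on U F.
Proof. by move=> PF r j; exact: poly_fun_Ck. Qed.

Lemma poly_map_differentiable k (F : 'rV[R]_n -> 'rV[R]_k) x :
  poly_map F -> differentiable F x.
Proof.
move=> PF.
rewrite (_ : F = \sum_j (fun y => F y 0 j *: stdbasis j)).
  by apply: differentiable_sum => j; apply/differentiableZl/poly_fun_differentiable.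
by apply/funext => y; rewrite fct_sumE; exact: row_sum_delta.
Qed.

Lemma jacobian_poly_map k (F : 'rV[R]_n -> 'rV[R]_k) x i j : poly_map F ->
  jacobian F x i j = partial i (fun y => F y 0 j) x.
Proof.
move=> PF; have dF := poly_map_differentiable x PF.
have /rowP/(_ j) := deriveEjacobian (stdbasis i) dF.
rewrite -rowE [in RHS]mxE => <-.
rewrite derive_mx ?mxE //; exact: diff_derivable.
Qed.

Lemma poly_fun_open f : poly_fun f -> open [set x | 0 < f x].
Proof.
move=> Pf; apply: (@open_comp _ _ f [set y | 0 < y]); last exact: open_gt.
by move=> x _; exact/differentiable_continuous/poly_fun_differentiable.
Qed.

End PolynomialFunctions.

(** * The two loci of maximal scalar curvature in the charts *)

Section Loci.
Context {R : realType} (L : lattice R).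

Lemma stereo_antidiag e (x : 'rV[R]_2) :
  stereo e x 0 0 = - stereo e x 0 2%:R <->
  2 * x 0 0 + (-1) ^+ e * (x 0 0 * x 0 0 + x 0 1 * x 0 1 + -1) = 0.
Proof.
rewrite !stereoE /stereo_coord /stereo_num /=.
have D0 : stereo_scale x != 0 by rewrite invr_eq0 stereo_den_neq0.
split=> E; last by apply/eqP; rewrite -subr_eq0 opprK -mulrDr E mulr0.
by apply: (mulfI D0); rewrite mulrDr {1}E mulr0; ring.
Qed.

Definition antidiag : set (S2xT2 L) :=
  [set q : S2xT2 L | val q.1 0 0 = - val q.1 0 2%:R].

Lemma antidiag_submanifold : submanifold 1 antidiag.
Proof.
move=> e a aN.
pose s : R := (-1) ^+ e.
have ss : s = 1 \/ s = -1 by exact: signr_cases.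
pose i0 : 'I_(2 + 2) := lshift 2 0; pose i1 : 'I_(2 + 2) := lshift 2 1.
pose f (u : 'rV[R]_(2 + 2)) := 2 * u 0 i0 + s * (u 0 i0 * u 0 i0 + u 0 i1 * u 0 i1 + -1).
(* Completing the square, s f = w - 2: over the base the locus is the circle of radius sqrt 2 about
   (-s, 0). The differential of f vanishes only over that centre, where w = 0. *)
pose w (u : 'rV[R]_(2 + 2)) := (u 0 i0 + s) * (u 0 i0 + s) + u 0 i1 * u 0 i1.
pose F u : 'rV[R]_1 := \row_j f u.
have fE u : antidiag (param L e u) <-> f u = 0.
  by rewrite /antidiag /= stereo_antidiag !mxE.
have PF : poly_map F.
  move=> j; rewrite (_ : (fun u => _) = f); last by apply/funext => u; rewrite mxE.
  by rewrite /f; do !constructor.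
exists [set u | 0 < w u], F; split.
- by apply: poly_fun_open; rewrite /w; do !constructor.
- move/fE : aN; rewrite /= /w /f => fa.
  suff -> : (a 0 i0 + s) * (a 0 i0 + s) + a 0 i1 * a 0 i1 = 2 by rewrite ltr0n.
  by case: ss fa => -> fa; lra.
- exact: poly_map_smooth.
- move=> u /= wu.
  have dF i : partial i (fun y => F y 0 0) u =
      2 * (stdbasis i 0 i0) + s * (2 * u 0 i0 * stdbasis i 0 i0 + 2 * u 0 i1 * stdbasis i 0 i1).
    rewrite (_ : (fun u => _) = f); last by apply/funext => v; rewrite mxE.
    apply: derive_val; apply: is_derive_eq; rewrite /f; derive_rules.
    by rewrite /GRing.scale /=; ring.
  apply/eqP; rewrite eqn_leq rank_leq_col lt0n mxrank_eq0; apply/eqP => J0.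
  have J i : jacobian F u i 0 = 0 by rewrite J0 mxE.
  have := J i0; have := J i1; rewrite !jacobian_poly_map // !dF !mxE /= => E1 E0.
  move: wu; rewrite /w; suff [-> ->] : u 0 i0 = - s /\ u 0 i1 = 0.
    by rewrite addNr !mul0r addr0 ltxx.
  by case: ss E0 E1 => -> E0 E1; split; lra.
- apply/seteqP; split=> u /= [] Nu wu; split => //.
    by apply/rowP => j; rewrite !mxE; apply/fE.
  by apply/fE; have /rowP/(_ 0) := Nu; rewrite !mxE.
Qed.

(** On the equator p_3 = 0 both stereographic projections reduce to (p_1, p_2), so the chart
    coordinates do not depend on [e]. *)
Lemma stereo_equator e (x : 'rV[R]_2) t : t = 1 \/ t = -1 ->
  stereo e x = vec3 0 t 0 <-> x 0 0 = 0 /\ x 0 1 = t.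
Proof.
move=> t1; have tt : t * t = 1 by case: t1 => ->; ring.
have D0 : stereo_scale x != 0 by rewrite invr_eq0 stereo_den_neq0.
split=> [E | [x0 x1]].
  have st_j j : stereo_coord e j x = vec3 0 t 0 0 j by rewrite -stereoE E.
  have := st_j 0; have := st_j 1; have := st_j 2%:R; rewrite !mxE /stereo_coord /stereo_num /=.
  move=> /eqP; rewrite !mulf_eq0 (negbTE D0) signr_eq0 /= subr_eq0 => /eqP q1 E1 E0.
  have x0 : x 0 0 = 0 by move/eqP: E0; rewrite !mulf_eq0 (negbTE D0) pnatr_eq0 => /eqP.
  split=> //; rewrite -E1 /stereo_scale q1; by field.
apply/rowP; apply: ord3P; rewrite stereoE !mxE /stereo_coord /stereo_num /stereo_scale /= x0 x1 tt.
- by rewrite !mulr0.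
- by field.
- by ring.
Qed.

(** Equatorial points, distinct from the projection poles (0, 0, +-1) of the charts. *)
Definition poles : set (sphere2 R) :=
  [set p : sphere2 R | val p = vec3 0 1 0 \/ val p = vec3 0 (- 1) 0].

Lemma poles_submanifold : submanifold 2 (poles `*` [set: torus L] : set (S2xT2 L)).
Proof.
move=> e a aN.
pose i0 : 'I_(2 + 2) := lshift 2 0; pose i1 : 'I_(2 + 2) := lshift 2 1.
have NE u : (poles `*` [set: torus L]) (param L e u) <->
    u 0 i0 = 0 /\ (u 0 i1 = 1 \/ u 0 i1 = -1).
  rewrite /poles /setX /=.
  have E1 := @stereo_equator e (lsubmx u) 1 (or_introl erefl).
  have E2 := @stereo_equator e (lsubmx u) (-1) (or_intror erefl).
  by rewrite E1 E2 !mxE; tauto.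
have [a0 at_] := (NE a).1 aN.
pose t := a 0 i1; have t1 : t = 1 \/ t = -1 by [].
pose F (u : 'rV[R]_(2 + 2)) : 'rV[R]_2 := \row_j [:: u 0 i0; u 0 i1 + - t]`_j.
have F0 u : F u 0 0 = u 0 i0.
  by rewrite mxE.
have F1 u : F u 0 1 = u 0 i1 + - t.
  by rewrite mxE.
have F0E : (fun u => F u 0 0) = (fun u => u 0 i0) by apply/funext.
have F1E : (fun u => F u 0 1) = (fun u => u 0 i1 + - t) by apply/funext.
have PF : poly_map F.
  by apply: ord2P; rewrite ?F0E ?F1E; do !constructor.
(* The preimage consists of two parallel planes, u_0 = 0 with u_1 = 1 or u_1 = -1; the sign
   condition keeps only the one through [a]. *)
exists [set u | 0 < t * u 0 i1], F; split.
- by apply: poly_fun_open; do !constructor.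
- by rewrite /= -/t; case: t1 => ->; rewrite ?mulrNN mulr1 ltr01.
- exact: poly_map_smooth.
- move=> u _; apply/eqP; rewrite eqn_leq rank_leq_col /=.
  (* The rows of the Jacobian for the two base directions form the identity, so the rank is at least
     2. *)
  have E : (\matrix_(i < 2) stdbasis (lshift 2 i)) *m jacobian F u = 1%:M.
    apply/matrixP => i j; transitivity (jacobian F u (lshift 2 i) j).
      set B := (_ *m _); have -> : B i j = row i B 0 j by rewrite [RHS]mxE.
      by rewrite row_mul rowK -rowE mxE.
    rewrite jacobian_poly_map //.
    move: j; apply: ord2P; rewrite ?F0E ?F1E; apply: derive_val;
      apply: is_derive_eq; derive_rules.
      by move: i; apply: ord2P; rewrite !mxE.
    by move: i; apply: ord2P; rewrite !mxE /= addr0.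
  by rewrite -{1}(mxrank1 R 2) -E; exact: mxrankM_maxr.
- apply/seteqP; split=> u /= [] Nu tu; split => //.
    have [u0 u1] := (NE u).1 Nu.
    apply/rowP; apply: ord2P; rewrite [RHS]mxE ?F0 ?F1 //.
    by case: t1 u1 tu => -> [] ->; lra.
  apply/NE; rewrite -F0 Nu mxE; split=> //.
  have : F u 0 1 = 0 by rewrite Nu mxE.
  by rewrite F1 => /eqP; rewrite subr_eq0 => /eqP ->.
Qed.

End Loci.

(** * Maximal scalar curvature *)

Section Extremal.
Context {R : realType} (L : lattice R).
Implicit Types (c : {linear 'rV[R]_2 -> S0 R 3}) (p : 'rV[R]_3).

Lemma scal_le2 c q : scal (g_lambda (L := L) c) q <= 2.
Proof.
rewrite scal_g_lambda /scalf.
have := sqr_ge0 (quad c 0 (val q.1)); have := sqr_ge0 (quad c 1 (val q.1)).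
by lra.
Qed.

Lemma scal_eq2 c q : scal (g_lambda (L := L) c) q = 2 <->
  quad c 0 (val q.1) = 0 /\ quad c 1 (val q.1) = 0.
Proof.
rewrite scal_g_lambda /scalf; split=> [E|[-> ->]]; last by ring.
have := sqr_ge0 (quad c 0 (val q.1)); have := sqr_ge0 (quad c 1 (val q.1)) => Q1 Q0.
by split; apply/eqP; rewrite -sqrf_eq0 eq_le; apply/andP; split=> //; lra.
Qed.

Lemma quad_diag c p : S0mx (c (stdbasis 0)) =
    mat3 [:: [:: -1; 0; 0]; [:: 0; 0; 0]; [:: 0; 0; 1]] ->
  quad c 0 p = p 0 2%:R ^+ 2 - p 0 0 ^+ 2.
Proof. by rewrite /quad => ->; rewrite dotE3 mxactE /dot3 /matvec !mxE /=; ring. Qed.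

Lemma quad_border c p : S0mx (c (stdbasis 1)) =
    mat3 [:: [:: 0; 1; 0]; [:: 1; 0; 1]; [:: 0; 1; 0]] ->
  quad c 1 p = 2 * p 0 1 * (p 0 0 + p 0 2%:R).
Proof. by rewrite /quad => ->; rewrite dotE3 mxactE /dot3 /matvec !mxE /=; ring. Qed.

Lemma quad_corner c p t : S0mx (c (stdbasis 1)) =
    mat3 [:: [:: 0; 0; t]; [:: 0; 0; 0]; [:: t; 0; 0]] ->
  quad c 1 p = 2 * t * (p 0 0 * p 0 2%:R).
Proof. by rewrite /quad => ->; rewrite dotE3 mxactE /dot3 /matvec !mxE /=; ring. Qed.

Lemma vec3_eq p x y z : p = vec3 x y z <-> [/\ p 0 0 = x, p 0 1 = y & p 0 2%:R = z].
Proof.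
split=> [->|[pa pb pc]]; first by rewrite !mxE.
by apply/rowP; apply: ord3P; rewrite ?pa ?pb ?pc mxE.
Qed.

Lemma sphere_eq (p : sphere2 R) :
  val p 0 0 ^+ 2 + val p 0 1 ^+ 2 + val p 0 2%:R ^+ 2 = 1.
Proof. by case: p => p /= /eqP; rewrite dotE3. Qed.

Lemma equator_sphere : dot (vec3 0 1 0 : 'rV[R]_3) (vec3 0 1 0) == 1.
Proof. by apply/eqP; rewrite dotE3 /dot3 !mxE /=; ring. Qed.

End Extremal.

Unset Implicit Arguments.

Theorem proposition2p10 (R : realType) (L : lattice R) (hL : uniform_lattice L)
  (c c' : {linear 'rV[R]_2 -> S0 R 3})
  (hc1 : S0mx (c (stdbasis 0)) = mat3 [:: [:: -1; 0; 0];
                                          [::  0; 0; 0];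
                                          [::  0; 0; 1]])
  (hc2 : S0mx (c (stdbasis 1)) = mat3 [:: [:: 0; 1; 0];
                                          [:: 1; 0; 1];
                                          [:: 0; 1; 0]])
  (hc'1 : S0mx (c' (stdbasis 0)) = mat3 [:: [:: -1; 0; 0];
                                            [::  0; 0; 0];
                                            [::  0; 0; 1]])
  (hc'2 : S0mx (c' (stdbasis 1)) = mat3 [:: [:: 0; 0; Num.sqrt 2];
                                            [:: 0; 0; 0];
                                            [:: Num.sqrt 2; 0; 0]]) :
  let s : S2xT2 L -> R := scal (g_lambda c) in
  let s' : S2xT2 L -> R := scal (g_lambda c') in
  let r : R := 1 / Num.sqrt 2 in
  [/\
      range s 2 /\ ubound (range s) 2,
      range s' 2 /\ ubound (range s') 2,
      s @^-1` [set 2] =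
        ([set p : sphere2 R | val p 0 0 = - val p 0 2%:R] `|`
         [set p : sphere2 R | val p = vec3 r 0 r \/
                              val p = vec3 (- r) 0 (- r)]) `*` [set: torus L]
      /\ (exists N : set (S2xT2 L),
            [/\ N `<=` s @^-1` [set 2], N !=set0 & submanifold 1 N])
    & s' @^-1` [set 2] =
        [set p : sphere2 R | val p = vec3 0 1 0 \/
                             val p = vec3 0 (- 1) 0] `*` [set: torus L]
      /\ submanifold 2 (s' @^-1` [set 2])].
Proof.
move=> s s' r.
have sqrt2 : Num.sqrt 2 != 0 :> R by rewrite sqrtr_eq0 -ltNge ltr0n.
have rr : r ^+ 2 = 1 / 2 by rewrite expr_div_n expr1n sqr_sqrtr ?ler0n.
(* A point in both loci: it attains the maximum for both metrics and shows that [antidiag] is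
   nonempty. *)
pose o : S2xT2 L := (exist _ (vec3 0 1 0) (@equator_sphere R), torus_proj L 0).
have sE q : s q = 2 <-> val q.1 0 0 = - val q.1 0 2%:R \/
    (val q.1 = vec3 r 0 r \/ val q.1 = vec3 (- r) 0 (- r)).
  rewrite /s scal_eq2 (quad_diag _ hc1) (quad_border _ hc2).
  move: (sphere_eq q.1); move: (val q.1) => p p1; rewrite !vec3_eq.
  split=> [[/eqP + /eqP]|].
    rewrite !mulf_eq0 pnatr_eq0 /= subr_sqr mulf_eq0 => /orP[/eqP p02|/eqP p02].
      (* Off the common factor p_1 + p_3 one is left with p_3 = p_1 and p_2 = 0; the sphere equation
         then gives 2 p_1^2 = 1. *)
      have {p02} p02 : p 0 2%:R = p 0 0 by apply/eqP; rewrite -subr_eq0 p02.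
      case/orP => /eqP p12; last by left; apply/eqP; rewrite -subr_eq0 opprK p12.
      have : (p 0 0 - r) * (p 0 0 + r) = 0.
        rewrite -subr_sqr rr; move: p1; rewrite p02 p12; lra.
      move=> /eqP; rewrite mulf_eq0 => /orP[] /eqP E; right; [left | right]; split=> //; lra.
    by move=> _; left; lra.
  case=> [-> | [] [-> -> ->]]; split; ring.
have s'E q : s' q = 2 <-> val q.1 = vec3 0 1 0 \/ val q.1 = vec3 0 (- 1) 0.
  rewrite /s' scal_eq2 (quad_diag _ hc'1) (quad_corner _ hc'2).
  move: (sphere_eq q.1); move: (val q.1) => p p1; rewrite !vec3_eq.
  split=> [[p02 /eqP]|]; last by case=> [] [-> _ ->]; split; ring.
  rewrite !mulf_eq0 pnatr_eq0 (negbTE sqrt2) /= => p00.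
  have {p00} p0 : p 0 0 = 0.
    case/orP : p00 => /eqP p0 //; apply/eqP; rewrite -sqrf_eq0; apply/eqP.
    by move: p02; rewrite p0; lra.
  have p2 : p 0 2%:R = 0.
    by apply/eqP; rewrite -sqrf_eq0; apply/eqP; move: p02; rewrite p0; lra.
  have : (p 0 1 - 1) * (p 0 1 + 1) = 0 by move: p1; rewrite p0 p2; lra.
  by move=> /eqP; rewrite mulf_eq0 => /orP[] /eqP E; [left | right]; split=> //; lra.
have pre : s @^-1` [set 2] =
    ([set p : sphere2 R | val p 0 0 = - val p 0 2%:R] `|`
     [set p : sphere2 R | val p = vec3 r 0 r \/
                          val p = vec3 (- r) 0 (- r)]) `*` [set: torus L].
  by apply/seteqP; split=> q /=; rewrite sE /=; [split | case].
have pre' : s' @^-1` [set 2] = poles `*` [set: torus L].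
  by apply/seteqP; split=> q /=; rewrite s'E /=; [split | case].
split.
- split; last by move=> _ [q _ <-]; exact: scal_le2.
  by exists o => //; apply/sE; left; rewrite /= !mxE /= oppr0.
- split; last by move=> _ [q _ <-]; exact: scal_le2.
  by exists o => //; apply/s'E; left.
(* The isolated points +-(r, 0, r) yield pieces of codimension two, so N is taken over the great
   circle only. *)
- split=> //; exists (@antidiag R L); split.
  + by move=> q qN /=; apply/sE; left.
  + by exists o; rewrite /antidiag /= !mxE /= oppr0.
  + exact: antidiag_submanifold.
- by rewrite pre'; split=> //; exact: poles_submanifold.
Qed.
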